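(* Let $(N,\nu)$ be the mixed-binary quadratic optimization game defined by $(Q,c,b(S),A,B)$ for each coalition $S\subseteq N$, i.e. $$\nu(S)=\min\{x^\top Qx+2c^\top x:\ Ax\le b(S),\ x\ge0,\ x_j\in\{0,1\}\ \forall j\in B\},\qquad b(S)=\sum_{i\in S}b(i).$$ Suppose that the completely positive program (CPP) for the grand coalition $N$ (given in the context) verifies the Slater condition and has an optimal dual price vector $(\alpha^\star,u^\star,v^\star,w^\star,y^\star,Y^\star)$, i.e. an optimal solution of the copositive dual program (COP) for $N$ (given in the context). Then the following claims hold. (i) If $y^\star\in\mathbb{R}^n_+$, then the core of $(N,\nu)$ is nonempty. (ii) If $$\frac1{|N|}\ \ge\ \sup_{\eta\ge0,\ \eta^\top y^\star<0}\ \frac{(\eta^\top y^\star)^2}{\alpha^\star\,\eta^\top Y^\star\eta},$$ then the core of $(N,\nu)$ is nonempty.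
   Context: $N$ is a finite set of players. $Q$ is a real symmetric $n\times n$ matrix, $c\in\mathbb{R}^n$, $A\in\mathbb{R}^{m\times n}$ with rows $a_1^\top,\dots,a_m^\top$, $B\subseteq\{1,\dots,n\}$, and $b:N\to\mathbb{R}^m$ gives the right-hand sides (resources) contributed by the players, pooled as $b(S)=\sum_{i\in S}b(i)$. ''min''/''max'' denote optimal values. Notation: $\mathcal{C}_k$ is the copositive cone of symmetric $k\times k$ matrices $M$ with $x^\top Mx\ge0$ for all $x\in\mathbb{R}^k_+$; $\mathcal{C}_k^*$ is the completely positive cone of matrices $\sum_lz_lz_l^\top$ (finite sums) with $z_l\in\mathbb{R}^k_+$. $\mathcal{A}$ is the linear map $\mathcal{A}X=(\langle a_ia_i^\top,X\rangle)_{i=1}^m$ with adjoint $\mathcal{A}^*(v)=\sum_iv_ia_ia_i^\top$; $\circ$ is the Hadamard product; $e_j$ is the $j$th canonical basis vector and $E_{jj}=\mathrm{diag}(e_j)$. (CPP) for coalition $S$: $$\min\ \langle Q,X\rangle+2c^\top x\quad\text{s.t.}\quad Ax\le b(S),\ \ \mathcal{A}X\le b(S)\circ b(S),\ \ X_{jj}=x_j\ \forall j\in B,\ \ \begin{bmatrix}1 & x^\top \\ x & X\end{bmatrix}\in\mathcal{C}^*_{n+1}.$$ (COP), the dual of (CPP), for coalition $S$: $$\max\ -\alpha-\langle u,b(S)\rangle-\langle v,b(S)\circ b(S)\rangle$$ $$\text{s.t.}\quad 2y=2c+A^\top u-\sum_{j\in B}w_je_j,\quad Y=Q+\mathcal{A}^*(v)+\sum_{j\in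 B}w_jE_{jj},\quad\begin{bmatrix}\alpha & y^\top \\ y & Y\end{bmatrix}\in\mathcal{C}_{n+1},$$ $$u,v\in\mathbb{R}^m_+,\ w\in\mathbb{R}^{|B|},\ \alpha\in\mathbb{R}.$$ Standing assumption and representation: for all $S$, $\{x\in\mathbb{R}^n_+:Ax=b(S)\}\subset\{x:0\le x_j\le1\ \forall j\in B\}$, and $\nu(S)$ is represented by (CPP), i.e. $\nu(S)$ equals the optimal value of (CPP) for $S$. The Slater condition means that there is a feasible point of the conic program (inequalities being written with nonnegative slack variables) lying in the interior of the cone: the inequalities hold strictly and the matrix lies in the interior of $\mathcal{C}^*_{n+1}$. $(N,\nu)$ is a cost game; its core is the set of $z\in\mathbb{R}^N$ with $\sum_{i\in N}z_i=\nu(N)$ and $\sum_{i\in S}z_i\le\nu(S)$ for all coalitions $\emptyset\ne S\subset N$.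
   Formalization: The formal theorem additionally assumes that every player's resource vector b(i) is componentwise nonnegative; without this the claim fails (e.g. Q=[[-1,1],[1,0]], A=[1 -1], c=0, B empty, b(1)=3, b(2)=-2). *)

(* Defs.v *)
From HB Require Import structures.
From mathcomp Require Import all_boot all_order all_algebra.
From mathcomp Require Import all_classical all_reals all_analysis.

Set Implicit Arguments.
Unset Strict Implicit.
Unset Printing Implicit Defensive.

Import Order.TTheory GRing.Theory Num.Theory.
Import numFieldNormedType.Exports.

Local Open Scope classical_set_scope.
Local Open Scope ring_scope.

Section Vectors.
Context {R : realType}.

Definition dotv (k : nat) (x y : 'cV[R]_k) : R := (x^T *m y) 0 0.

Definition frobenius (k : nat) (X Y : 'M[R]_k) : R := \tr (X^T *m Y).

Definition qform (k : nat) (M : 'M[R]_k) (x : 'cV[R]_k) : R :=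
  (x^T *m M *m x) 0 0.

Definition hadamard (k : nat) (x y : 'cV[R]_k) : 'cV[R]_k := map2_mx *%R x y.

Definition lev (k : nat) (x y : 'cV[R]_k) : Prop := forall i, x i 0 <= y i 0.

Definition ltv (k : nat) (x y : 'cV[R]_k) : Prop := forall i, x i 0 < y i 0.

Definition nonnegv (k : nat) (x : 'cV[R]_k) : Prop := lev 0 x.

Definition unitv (k : nat) (j : 'I_k) : 'cV[R]_k := delta_mx j 0.

Definition symmetric_mx (k : nat) : set 'M[R]_k := [set M | M^T = M].

Definition copositive (k : nat) : set 'M[R]_k :=
  [set M | symmetric_mx M /\ forall x, nonnegv x -> 0 <= qform M x].

Definition completely_positive (k : nat) : set 'M[R]_k :=
  [set M | exists (l : nat) (z : 'I_l -> 'cV[R]_k),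
     (forall i, nonnegv (z i)) /\ M = \sum_(i < l) z i *m (z i)^T].

(* The ambient space of the cones is that of the symmetric matrices, a proper
   subspace of 'M[R]_k in which the cones have empty interior for k >= 2:
   interiors are taken relatively to it. *)
Definition symmetric_interior (k : nat) (C : set 'M[R]_k) : set 'M[R]_k :=
  [set M | symmetric_mx M /\ within (@symmetric_mx k) (nbhs M) C].

(* The symmetric matrix [[a, x^T], [x, X]]. *)
Definition bordered (n : nat) (a : R) (x : 'cV[R]_n) (X : 'M[R]_n) :
  'M[R]_(1 + n) := block_mx a%:M x^T x X.

End Vectors.

Section Programs.
Context {R : realType} {n m : nat}.
Implicit Types (Q X : 'M[R]_n) (c x : 'cV[R]_n) (A : 'M[R]_(m, n)).
Implicit Types (B : {set 'I_n}) (beta v : 'cV[R]_m).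

Definition row_square A (i : 'I_m) : 'M[R]_n := (row i A)^T *m row i A.

Definition row_square_map A X : 'cV[R]_m :=
  \col_i frobenius (row_square A i) X.

Definition row_square_adj A v : 'M[R]_n := \sum_i v i 0 *: row_square A i.

(* In all programs below, beta is the right-hand side b(S), and optimal values
   are taken in the extended reals, without requiring attainment. *)

Definition mbqp_feasible A B beta : set 'cV[R]_n :=
  [set x | [/\ lev (A *m x) beta, nonnegv x &
               forall j, j \in B -> x j 0 = 0 \/ x j 0 = 1]].

Definition mbqp_value Q c A B beta : \bar R :=
  ereal_inf [set (qform Q x + 2 * dotv c x)%:E | x in mbqp_feasible A B beta].

Definition cpp_feasible A B beta : set ('cV[R]_n * 'M[R]_n) :=
  [set p | [/\ lev (A *m p.1) beta,
               lev (row_square_map A p.2) (hadamard beta beta),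
               forall j, j \in B -> p.2 j j = p.1 j 0 &
               completely_positive (bordered 1 p.1 p.2)]].

Definition cpp_value Q c A B beta : \bar R :=
  ereal_inf [set (frobenius Q p.2 + 2 * dotv c p.1)%:E
            | p in cpp_feasible A B beta].

Definition cpp_slater A B beta : Prop :=
  exists p : 'cV[R]_n * 'M[R]_n,
    [/\ cpp_feasible A B beta p,
        ltv (A *m p.1) beta,
        ltv (row_square_map A p.2) (hadamard beta beta) &
        symmetric_interior (@completely_positive R (1 + n))
          (bordered 1 p.1 p.2)].

End Programs.

(* The multiplier w of the constraints X_jj = x_j, j in B, is a vector of R^n
   of which only the coordinates in B are ever used. *)
Record cop_point (R : realType) (n m : nat) := CopPoint {
  cop_alpha : R;
  cop_u : 'cV[R]_m;
  cop_v : 'cV[R]_m;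
  cop_w : 'cV[R]_n;
  cop_y : 'cV[R]_n;
  cop_Y : 'M[R]_n
}.

Section Dual.
Context {R : realType} {n m : nat}.
Implicit Types (Q : 'M[R]_n) (c : 'cV[R]_n) (A : 'M[R]_(m, n)).
Implicit Types (B : {set 'I_n}) (beta : 'cV[R]_m) (d : cop_point R n m).

Definition cop_feasible Q c A B : set (cop_point R n m) :=
  [set d | [/\ 2 *: cop_y d = 2 *: c + A^T *m cop_u d
                 - \sum_(j in B) cop_w d j 0 *: unitv j,
               cop_Y d = Q + row_square_adj A (cop_v d)
                 + \sum_(j in B) cop_w d j 0 *: delta_mx j j,
               copositive (bordered (cop_alpha d) (cop_y d) (cop_Y d)),
               nonnegv (cop_u d) &
               nonnegv (cop_v d)]].

Definition cop_objective beta d : R :=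
  - cop_alpha d - dotv (cop_u d) beta - dotv (cop_v d) (hadamard beta beta).

Definition cop_optimal Q c A B beta d : Prop :=
  cop_feasible Q c A B d /\
  forall d', cop_feasible Q c A B d' ->
    cop_objective beta d' <= cop_objective beta d.

(* If d is feasible and eta^T y < 0 with eta >= 0, copositivity of the bordered
   matrix forces alpha > 0 and eta^T Y eta > 0, so the quotient is a genuine
   one; the supremum is -oo when there is no such eta. *)
Definition cop_ratio_sup d : \bar R :=
  ereal_sup [set ((dotv eta (cop_y d)) ^+ 2
                   / (cop_alpha d * qform (cop_Y d) eta))%:E
            | eta in [set eta | nonnegv eta /\ dotv eta (cop_y d) < 0]].

End Dual.

Section Games.
Context {R : realType} {N : finType}.

Definition pooled (m : nat) (b : N -> 'cV[R]_m) (S : {set N}) : 'cV[R]_m :=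
  \sum_(i in S) b i.

Definition core (nu : {set N} -> R) : set (N -> R) :=
  [set z | \sum_i z i = nu (finset.setTfor N) /\
           forall S : {set N}, S != finset.set0 -> \sum_(i in S) z i <= nu S].

End Games.

(* Main.v *)
Require Import Defs.
From HB Require Import structures.
From mathcomp Require Import all_boot all_order all_algebra.
From mathcomp Require Import all_classical all_reals all_analysis.
From mathcomp Require Import ring lra.

Set Implicit Arguments.
Unset Strict Implicit.
Unset Printing Implicit Defensive.

Import Order.TTheory GRing.Theory Num.Theory.
Import numFieldNormedType.Exports.

Local Open Scope classical_set_scope.
Local Open Scope ring_scope.

(** Both claims are proved by pricing the resources with the optimal dual
    vector. Player i pays
      z_i = - alpha / |N| - <u, b(i)> - <v, b(i) o b(N)>.
    Three facts make z a core allocation.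

    - Budget balance. Summing over N gives the dual optimal value, which equals
      nu(N) by strong duality ([cpp_strong_duality]), where the Slater point
      supplies an attained dual optimum. The multipliers come from a
      finite-dimensional sandwich argument ([multiplier_exists]): a convex cone
      of pairs (constraint values, cost) that reaches every constraint value and
      contains no pair (0, r) with r < 0 lies above the graph of a linear form.
      The cone used is the one of the homogenised program, in which the corner
      entry 1 of the bordered matrix is replaced by a free t.

    - Coalitions. As b >= 0 and v >= 0, <v, b(S) o b(N)> is at least
      <v, b(S) o b(S)>. Hence the share z(S) is at most the dual objective, for
      the resources b(S), of the same prices with alpha replaced by
      alpha |S| / |N|. Weak duality ([cop_cpp_weak_duality]) bounds it by
      nu(S), provided that this replacement keeps the prices dual feasible.

    - Feasibility of the replacement. For nonempty S it is enough that the
      bordered matrix of (alpha / |N|, y, Y) is copositive, that is,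
      (alpha / |N|) t^2 + 2 t <y, x> + x^T Y x >= 0 for t, x >= 0. If y >= 0,
      every term is nonnegative. In general only the x with <y, x> < 0 matter,
      and for them the bound on the supremum says that this quadratic in t has
      a nonpositive discriminant ([copositive_bordered_ratio]). *)

(** * Inner products of vectors and matrices *)

Section BilinearForms.
Context {R : realType}.

Lemma dotvE k (x y : 'cV[R]_k) : dotv x y = \sum_i x i 0 * y i 0.
Proof. by rewrite /dotv mxE; apply: eq_bigr => i _; rewrite mxE. Qed.

Lemma dotvC k (x y : 'cV[R]_k) : dotv x y = dotv y x.
Proof. by rewrite !dotvE; apply: eq_bigr => i _; rewrite mulrC. Qed.

Lemma dotvDr k (x y z : 'cV[R]_k) : dotv x (y + z) = dotv x y + dotv x z.
Proof. by rewrite /dotv mulmxDr mxE. Qed.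

Lemma dotvZr k (x y : 'cV[R]_k) a : dotv x (a *: y) = a * dotv x y.
Proof. by rewrite /dotv -scalemxAr mxE. Qed.

Lemma dotvDl k (x y z : 'cV[R]_k) : dotv (x + y) z = dotv x z + dotv y z.
Proof. by rewrite dotvC dotvDr !(dotvC z). Qed.

Lemma dotvZl k (x y : 'cV[R]_k) a : dotv (a *: x) y = a * dotv x y.
Proof. by rewrite dotvC dotvZr dotvC. Qed.

Lemma dotvNl k (x y : 'cV[R]_k) : dotv (- x) y = - dotv x y.
Proof. by rewrite -scaleN1r dotvZl mulN1r. Qed.

Lemma dotvNr k (x y : 'cV[R]_k) : dotv x (- y) = - dotv x y.
Proof. by rewrite dotvC dotvNl dotvC. Qed.

Lemma dotv0r k (x : 'cV[R]_k) : dotv x 0 = 0.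
Proof. by rewrite /dotv mulmx0 mxE. Qed.

Lemma dotv_sumr (I : Type) (s : seq I) (P : pred I) k (x : 'cV[R]_k)
    (F : I -> 'cV[R]_k) :
  dotv x (\sum_(i <- s | P i) F i) = \sum_(i <- s | P i) dotv x (F i).
Proof. by rewrite /dotv mulmx_sumr summxE. Qed.

Lemma dotv_suml (I : Type) (s : seq I) (P : pred I) k (x : 'cV[R]_k)
    (F : I -> 'cV[R]_k) :
  dotv (\sum_(i <- s | P i) F i) x = \sum_(i <- s | P i) dotv (F i) x.
Proof. by rewrite dotvC dotv_sumr; apply: eq_bigr => i _; rewrite dotvC. Qed.

Lemma dotv_col k l (x1 y1 : 'cV[R]_k) (x2 y2 : 'cV[R]_l) :
  dotv (col_mx x1 x2) (col_mx y1 y2) = dotv x1 y1 + dotv x2 y2.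
Proof. by rewrite /dotv tr_col_mx mul_row_col mxE. Qed.

Lemma dotv_unit k (x : 'cV[R]_k) j : dotv (unitv j) x = x j 0.
Proof. by rewrite /dotv trmx_delta -rowE mxE. Qed.

Lemma dotv_mulmx k l (A : 'M[R]_(k, l)) u x :
  dotv (A^T *m u) x = dotv u (A *m x).
Proof. by rewrite /dotv trmx_mul trmxK mulmxA. Qed.

Lemma dotv_ge0 k (x y : 'cV[R]_k) : nonnegv x -> nonnegv y -> 0 <= dotv x y.
Proof.
move=> x0 y0; rewrite dotvE sumr_ge0 // => i _.
by have := x0 i; have := y0 i; rewrite !mxE => ? ?; rewrite mulr_ge0.
Qed.

Lemma ler_dotvr k (u x y : 'cV[R]_k) :
  nonnegv u -> lev x y -> dotv u x <= dotv u y.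
Proof.
move=> u0 xy; rewrite !dotvE ler_sum // => i _.
by have := u0 i; rewrite mxE => ?; rewrite ler_wpM2l.
Qed.

Lemma frobeniusDl k (X Y Z : 'M[R]_k) :
  frobenius (X + Y) Z = frobenius X Z + frobenius Y Z.
Proof. by rewrite /frobenius raddfD /= mulmxDl raddfD. Qed.

Lemma frobeniusDr k (X Y Z : 'M[R]_k) :
  frobenius X (Y + Z) = frobenius X Y + frobenius X Z.
Proof. by rewrite /frobenius mulmxDr raddfD. Qed.

Lemma frobeniusZl k (X Y : 'M[R]_k) a :
  frobenius (a *: X) Y = a * frobenius X Y.
Proof. by rewrite /frobenius linearZ /= -scalemxAl linearZ. Qed.

Lemma frobeniusZr k (X Y : 'M[R]_k) a :
  frobenius X (a *: Y) = a * frobenius X Y.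
Proof. by rewrite /frobenius -scalemxAr linearZ. Qed.

Lemma frobenius_suml (I : Type) (s : seq I) (P : pred I) k (X : 'M[R]_k)
    (F : I -> 'M[R]_k) :
  frobenius (\sum_(i <- s | P i) F i) X = \sum_(i <- s | P i) frobenius (F i) X.
Proof. by rewrite /frobenius raddf_sum mulmx_suml raddf_sum. Qed.

Lemma frobenius_sumr (I : Type) (s : seq I) (P : pred I) k (X : 'M[R]_k)
    (F : I -> 'M[R]_k) :
  frobenius X (\sum_(i <- s | P i) F i) = \sum_(i <- s | P i) frobenius X (F i).
Proof. by rewrite /frobenius mulmx_sumr raddf_sum. Qed.

Lemma frobenius_outer k (M : 'M[R]_k) z : frobenius M (z *m z^T) = qform M z.
Proof.
rewrite /frobenius mulmxA mxtrace_mulC /mxtrace big_ord1 /qform.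
have -> : z^T *m (M^T *m z) = (z^T *m M *m z)^T by rewrite !trmx_mul trmxK.
by rewrite mxE.
Qed.

Lemma frobenius_delta k (X : 'M[R]_k) j : frobenius (delta_mx j j) X = X j j.
Proof.
rewrite -(mul_delta_mx (0 : 'I_1)) /frobenius trmx_mul !trmx_delta -mulmxA.
by rewrite mxtrace_mulC /mxtrace big_ord1 -rowE -colE !mxE.
Qed.

End BilinearForms.

(** * Existence of multipliers for a convex cone *)

Section Multipliers.
Context {R : realType}.

(** Here C g r reads: the constraint value g can be reached at cost r. No
    closedness is needed, since every constraint value can be reached. The proof
    is by induction on the number of constraints: the first multiplier is
    squeezed between the bounds coming from the first coordinates -1 and 1. *)
Lemma multiplier_exists k (C : 'cV[R]_k -> R -> Prop) :
    (forall g r h s, C g r -> C h s -> C (g + h) (r + s)) ->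
    (forall (a : R) g r, 0 < a -> C g r -> C (a *: g) (a * r)) ->
    (forall r, C 0 r -> 0 <= r) ->
    (forall g, exists r, C g r) ->
  exists l, forall g r, C g r -> dotv l g <= r.
Proof.
elim: k C => [|k IH] C CD CZ C0 CT.
  by exists 0 => g r; rewrite (flatmx0 g) => /C0; rewrite dotvE big_ord0.
(* pt a g has height (first coordinate) a. *)
pose pt (a : R) (g : 'cV[R]_k) : 'cV[R]_k.+1 := col_mx (a%:M : 'cV_1) g.
have ptD a g a' g' : pt a g + pt a' g' = pt (a + a') (g + g').
  by rewrite [LHS](@add_col_mx _ 1 k 1) -raddfD.
have ptZ s a g : s *: pt a g = pt (s * a) (s *: g).
  by rewrite [LHS](@scale_col_mx _ 1 k 1) scale_scalar_mx.
have pt0 : pt 0 0 = 0 by rewrite /pt raddf0 [LHS](@col_mx0 _ 1 k 1).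
have ptE g : exists a g', g = pt a g'.
  exists (usubmx (g : 'cV_(1 + k)) 0 0), (dsubmx (g : 'cV_(1 + k))).
  by rewrite /pt -mx11_scalar vsubmxK.
(* Multipliers of the other constraints, on the slice of height 0. *)
have [l lP] : exists l, forall g r, C (pt 0 g) r -> dotv l g <= r.
  apply: IH => [g r h s Cg Ch|a g r a0 Cg|r|g]; last exact: CT.
  - by have := CD _ _ _ _ Cg Ch; rewrite ptD addr0.
  - by have := CZ _ _ _ a0 Cg; rewrite ptZ mulr0.
  - by rewrite pt0; apply: C0.
pose E := [set s : R | exists g r, C (pt 1 g) r /\ s = r - dotv l g].
(* Points of C at heights 1 and -1 add up to a point at height 0, so that
   inf E separates the bounds coming from these two heights. *)
have sep g r h s : C (pt 1 g) r -> C (pt (-1) h) s ->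
    dotv l h - s <= r - dotv l g.
  move=> Cg Ch; have := CD _ _ _ _ Cg Ch.
  by rewrite ptD subrr => /lP; rewrite dotvDr; lra.
have E0 : E !=set0.
  by have [r Cr] := CT (pt 1 0); exists (r - dotv l 0), 0, r.
have lbE h s : C (pt (-1) h) s -> lbound E (dotv l h - s).
  by move=> Ch _ [g [r [Cg ->]]]; exact: sep Cg Ch.
have hE : has_lbound E.
  by have [s Cs] := CT (pt (-1) 0); exists (dotv l 0 - s); exact: lbE.
exists (pt (inf E) l) => g r; have [a [{}g ->]] := ptE g.
have -> : dotv (pt (inf E) l) (pt a g) = inf E * a + dotv l g.
  by rewrite [LHS](@dotv_col R 1 k) dotvE big_ord1 !mxE /= !mulr1n.
have [a0|a0|->] := ltgtP a 0; last by move=> /lP; rewrite mulr0 add0r.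
- move=> Cg; have na : 0 < (- a)^-1 by rewrite invr_gt0; lra.
  have := CZ _ _ _ na Cg; rewrite ptZ.
  have -> : (- a)^-1 * a = - 1 by rewrite invrN mulNr mulVf // lt_eqF.
  move=> /lbE lb; have := lb_le_inf E0 lb.
  by rewrite dotvZr -mulrBr mulrC ler_pdivrMr; lra.
- move=> Cg; have pa : 0 < a^-1 by rewrite invr_gt0.
  have := CZ _ _ _ pa Cg; rewrite ptZ mulVf ?gt_eqF //.
  move=> {}Cg; have : E (a^-1 * r - dotv l (a^-1 *: g)).
    by exists (a^-1 *: g), (a^-1 * r).
  move=> /(ge_inf hE); rewrite dotvZr -mulrBr.
  by rewrite mulrC ler_pdivlMr; lra.
Qed.

End Multipliers.

(** * Copositive and completely positive bordered matrices *)

Section CompletelyPositive.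
Context {R : realType}.

Lemma cp0 k : @completely_positive R k 0.
Proof.
exists 0%N, (fun _ => 0); split; last by rewrite big_ord0.
by move=> [].
Qed.

Lemma cp_outer k (z : 'cV[R]_k) : nonnegv z -> completely_positive (z *m z^T).
Proof. by move=> z0; exists 1%N, (fun _ => z); rewrite big_ord1. Qed.

Lemma cpD k (M M' : 'M[R]_k) :
  completely_positive M -> completely_positive M' ->
  completely_positive (M + M').
Proof.
move=> [l [z [z0 ->]]] [l' [z' [z'0 ->]]].
exists (l + l')%N, (fun i =>
  match fintype.split i with inl a => z a | inr a => z' a end).
split; first by move=> i; case: fintype.split.
rewrite big_split_ord; congr (_ + _); apply: eq_bigr => i _.
  by rewrite (unsplitK (inl _ i)).
by rewrite (unsplitK (inr _ i)).
Qed.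

Lemma cpZ k (M : 'M[R]_k) a :
  0 <= a -> completely_positive M -> completely_positive (a *: M).
Proof.
move=> a0 [l [z [z0 ->]]]; exists l, (fun i => Num.sqrt a *: z i); split.
  by move=> i j; have := z0 i j; rewrite !mxE => ?; rewrite mulr_ge0 ?sqrtr_ge0.
rewrite scaler_sumr; apply: eq_bigr => i _.
by rewrite linearZ /= -scalemxAl -scalemxAr scalerA -expr2 sqr_sqrtr.
Qed.

Lemma cp_diag_ge0 k (M : 'M[R]_k) i : completely_positive M -> 0 <= M i i.
Proof.
move=> [l [z [z0 ->]]]; rewrite summxE sumr_ge0 // => j _.
by rewrite mxE big_ord1 mxE -expr2 sqr_ge0.
Qed.

Lemma copositive_cp_ge0 k (M X : 'M[R]_k) :
  copositive M -> completely_positive X -> 0 <= frobenius M X.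
Proof.
move=> [_ Mc] [l [z [z0 ->]]]; rewrite frobenius_sumr sumr_ge0 // => i _.
by rewrite frobenius_outer; apply: Mc.
Qed.

Lemma borderedD n (a b : R) (x y : 'cV[R]_n) X Y :
  bordered a x X + bordered b y Y = bordered (a + b) (x + y) (X + Y).
Proof. by rewrite /bordered add_block_mx !raddfD. Qed.

Lemma borderedZ n (s a : R) (x : 'cV[R]_n) X :
  s *: bordered a x X = bordered (s * a) (s *: x) (s *: X).
Proof. by rewrite /bordered scale_block_mx scale_scalar_mx linearZ. Qed.

Lemma bordered0 n : bordered 0 (0 : 'cV[R]_n) 0 = 0.
Proof. by rewrite /bordered raddf0 trmx0 block_mx0. Qed.

Lemma bordered_sym n (a : R) (x : 'cV[R]_n) X :
  symmetric_mx X -> symmetric_mx (bordered a x X).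
Proof.
by rewrite /symmetric_mx /= /bordered tr_block_mx trmxK tr_scalar_mx => ->.
Qed.

Lemma bordered_outer n (t : R) (x : 'cV[R]_n) :
  col_mx (t%:M : 'cV_1) x *m (col_mx (t%:M : 'cV_1) x)^T =
  bordered (t ^+ 2) (t *: x) (x *m x^T).
Proof.
rewrite tr_col_mx mul_col_row tr_scalar_mx -scalar_mxM mul_scalar_mx.
by rewrite mul_mx_scalar /bordered linearZ expr2.
Qed.

Lemma frobenius_bordered n (a t : R) (x y : 'cV[R]_n) X Y :
  frobenius (bordered a y Y) (bordered t x X) =
  a * t + 2 * dotv y x + frobenius Y X.
Proof.
have trE (u v : 'cV[R]_n) : \tr (u^T *m v) = dotv u v by rewrite trace_mx11.
rewrite /frobenius /bordered tr_block_mx mulmx_block mxtrace_block trmxK.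
rewrite !raddfD /= (mxtrace_mulC y) !trE (dotvC x).
rewrite tr_scalar_mx -scalar_mxM mxtrace_scalar.
ring.
Qed.

Lemma cp_bordered_ge0 n t (x : 'cV[R]_n) X :
  completely_positive (bordered t x X) -> 0 <= t.
Proof. by move=> /(cp_diag_ge0 (lshift n 0)); rewrite block_mxEul mxE. Qed.

Lemma nonnegv_col k l (x : 'cV[R]_k) (y : 'cV[R]_l) :
  nonnegv (col_mx x y) <-> nonnegv x /\ nonnegv y.
Proof.
split=> [h|[hx hy] i].
  split=> i; first by have := h (lshift l i); rewrite col_mxEu !mxE.
  by have := h (rshift k i); rewrite col_mxEd !mxE.
rewrite -(splitK i) mxE; case: (fintype.split i) => j.
  by rewrite col_mxEu; have := hx j; rewrite mxE.
by rewrite col_mxEd; have := hy j; rewrite mxE.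
Qed.

(** Copositivity of a bordered matrix, tested on the vectors with blocks t
    and x. *)
Lemma copositive_bordered n (a : R) (y : 'cV[R]_n) Y :
  copositive (bordered a y Y) <->
  symmetric_mx Y /\ forall t x, 0 <= t -> nonnegv x ->
    0 <= a * t ^+ 2 + 2 * (t * dotv y x) + qform Y x.
Proof.
have qE t x : qform (bordered a y Y) (col_mx (t%:M : 'cV_1) x) =
    a * t ^+ 2 + 2 * (t * dotv y x) + qform Y x.
  by rewrite -frobenius_outer bordered_outer frobenius_bordered dotvZr
     frobenius_outer.
split=> [[sM cM]|[sY cY]]; split.
- move: sM; rewrite /symmetric_mx /= /bordered tr_block_mx.
  by move=> /eq_block_mx[].
- move=> t x t0 x0; rewrite -qE; apply: cM; apply/nonnegv_col; split=> //.
  by move=> i; rewrite ord1 !mxE mulr1n.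
- exact: bordered_sym.
- move=> z; rewrite -(vsubmxK (z : 'cV_(1 + n))) => /nonnegv_col[t0 x0].
  rewrite [usubmx _]mx11_scalar qE; apply: cY => //.
  by have := t0 0; rewrite !mxE.
Qed.

Lemma copositive_bordered_le k (a a' : R) (y : 'cV[R]_k) Y : a <= a' ->
  copositive (bordered a y Y) -> copositive (bordered a' y Y).
Proof.
move=> aa' /copositive_bordered[sY cY]; apply/copositive_bordered; split=> //.
move=> t x t0 x0; apply: le_trans (cY t x t0 x0) _.
by rewrite lerD2r lerD2r ler_wpM2r // sqr_ge0.
Qed.

Lemma copositive_bordered_ge0 k (a : R) (y : 'cV[R]_k) Y :
  copositive (bordered a y Y) -> 0 <= a.
Proof.
move=> /copositive_bordered[_ /(_ 1 0 ler01)].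
rewrite dotv0r /qform mulmx0 mxE expr1n mulr0 mulr0 !addr0 mulr1; apply.
by move=> i; rewrite lexx.
Qed.

Lemma copositive_bordered_nonneg k (a a' : R) (y : 'cV[R]_k) Y :
    nonnegv y -> 0 <= a' ->
  copositive (bordered a y Y) -> copositive (bordered a' y Y).
Proof.
move=> y0 a0 /copositive_bordered[sY cY]; apply/copositive_bordered; split=> //.
move=> t x t0 x0; have := cY 0 x (lexx 0) x0.
rewrite expr0n /= mulr0 mul0r mulr0 !add0r => Yx.
by rewrite !addr_ge0 ?mulr_ge0 ?sqr_ge0 // dotv_ge0.
Qed.

(** A large t forces a > 0, a small positive t forces r > 0. *)
Lemma quadratic_neg_pos (a q r : R) : q < 0 ->
    (forall t, 0 <= t -> 0 <= a * t ^+ 2 + 2 * (t * q) + r) ->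
  0 < a /\ 0 < r.
Proof.
move=> q0 h.
have r0 : 0 <= r.
  by have := h 0 (lexx 0); rewrite expr0n /= mulr0 mul0r mulr0 !add0r.
split; rewrite ltNge; apply/negP => le0.
- have q'0 : 0 < - q by lra.
  (* At this t the linear term is - 2 (r + 1), which outweighs r. *)
  pose t := (r + 1) / - q.
  have t0 : 0 <= t by rewrite divr_ge0 // ?(ltW q'0) // addr_ge0.
  have := h t t0; have -> : t * q = - (r + 1) by rewrite /t; field; lra.
  have := sqr_ge0 t; nra.
- have rE : r = 0 by lra.
  have a1 : 0 < 1 + `|a| by rewrite ltr_pwDl.
  (* With r = 0, at t = - q / (1 + |a|) the linear term dominates. *)
  have t0 : 0 < - q / (1 + `|a|) by rewrite divr_gt0 // oppr_gt0.
  have := h _ (ltW t0); set t := _ / _ in t0 *.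
  have qE : q = - t * (1 + `|a|) by rewrite /t; field; lra.
  have := ler_norm a; rewrite rE qE => aa.
  have : 0 < t ^+ 2 by rewrite exprn_gt0.
  nra.
Qed.

(** Where <y, x> is negative, the bound on the supremum reads
    <y, x>^2 <= (s alpha) (x^T Y x): the quadratic polynomial in t with leading
    coefficient s alpha has a nonpositive discriminant. *)
Lemma copositive_bordered_ratio n m (d : cop_point R n m) (s : R) :
    0 < s -> (cop_ratio_sup d <= s%:E)%E ->
    copositive (bordered (cop_alpha d) (cop_y d) (cop_Y d)) ->
  copositive (bordered (s * cop_alpha d) (cop_y d) (cop_Y d)).
Proof.
move=> s0 sup_le Mc; have /copositive_bordered[sY cY] := Mc.
apply/copositive_bordered; split=> // t x t0 x0.
have [q0|q0] := leP 0 (dotv (cop_y d) x).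
  have := copositive_bordered_ge0 Mc => a0.
  have := cY 0 x (lexx 0) x0.
  rewrite expr0n /= mulr0 mul0r mulr0 !add0r => Yx.
  by rewrite !addr_ge0 // !mulr_ge0 ?sqr_ge0 // ltW.
have [a0 r0] := quadratic_neg_pos q0 (fun t t0 => cY t x t0 x0).
have : (((dotv x (cop_y d)) ^+ 2 /
   (cop_alpha d * qform (cop_Y d) x))%:E <= s%:E)%E.
  apply: le_trans sup_le; apply: ereal_sup_ubound; exists x => //.
  by split=> //; rewrite dotvC.
rewrite lee_fin ler_pdivrMr ?mulr_gt0 // dotvC mulrA => disc.
have sa0 : 0 < s * cop_alpha d by rewrite mulr_gt0.
rewrite -(pmulr_rge0 _ sa0).
(* Completing the square, after multiplication by the leading coefficient. *)
have := sqr_ge0 (s * cop_alpha d * t + dotv (cop_y d) x).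
move: disc; nra.
Qed.

End CompletelyPositive.

(** * Small perturbations of a strictly feasible point *)

Section Interior.
Context {R : realType}.

Lemma symmetric_interior_near k (K : set 'M[R]_k) M D :
    symmetric_interior K M -> symmetric_mx D ->
  \forall e \near (0 : R)^'+, K (M + e *: D).
Proof.
move=> [sM /= /nbhs_ballP [r /= r0 MK]] sD.
(* A bound on all entries of D, made positive. *)
pose s := 1 + \sum_i \sum_j `|D i j|.
have s0 : 0 < s.
  by apply: ltr_pwDl => //; apply: sumr_ge0 => i _; apply: sumr_ge0.
near=> e.
have e0 : 0 < e by near: e; exact: nbhs_right_gt.
have es : e * s < r.
  rewrite -ltr_pdivlMr //; near: e; apply: nbhs_right_lt.
  exact: divr_gt0.
apply: (MK (M + e *: D)); last first.
  by move: sM sD; rewrite /symmetric_mx /= linearD linearZ /= => -> ->.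
split=> // i j; rewrite /ball /= !mxE opprD addrA subrr add0r normrN normrM.
rewrite (gtr0_norm e0); apply: le_lt_trans es; rewrite ler_pM2l //.
(* The entry |D i j| is one of the nonnegative terms of s. *)
rewrite /s (bigD1 i) //= (bigD1 j) //=.
have h1 : 0 <= \sum_(k0 < k | k0 != j) `|D i k0| by apply: sumr_ge0.
have h2 : 0 <= \sum_(i0 < k | i0 != i) \sum_j0 `|D i0 j0|.
  by apply: sumr_ge0 => ? _; apply: sumr_ge0.
by move: h1 h2; lra.
Unshelve. all: by end_near. Qed.

Lemma neg_near_le_scale (a g : R) : a < 0 ->
  \forall e \near (0 : R)^'+, a <= e * g.
Proof.
move=> a0; near=> e.
have e0 : 0 < e by near: e; exact: nbhs_right_gt.
have g0 : 0 < 1 + `|g| by rewrite ltr_pwDl.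
have : e * (1 + `|g|) < - a.
  rewrite -ltr_pdivlMr //; near: e; apply: nbhs_right_lt.
  by rewrite divr_gt0 // oppr_gt0.
have : e * - g <= e * `|g| by rewrite ler_pM2l // -normrN ler_norm.
nra.
Unshelve. all: by end_near. Qed.

End Interior.

(** * Duality between the completely positive and the copositive programs *)

Section Duality.
Context {R : realType} {n m : nat}.
Variables (Q : 'M[R]_n) (c : 'cV[R]_n) (A : 'M[R]_(m, n)) (B : {set 'I_n}).
Variable (beta : 'cV[R]_m).

(** The objective function of the completely positive program. *)
Definition cpp_cost (x : 'cV[R]_n) (X : 'M[R]_n) : R :=
  frobenius Q X + 2 * dotv c x.

Lemma cpp_costD x y X Y :
  cpp_cost (x + y) (X + Y) = cpp_cost x X + cpp_cost y Y.
Proof. by rewrite /cpp_cost frobeniusDr dotvDr; ring. Qed.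

Lemma cpp_costZ a x X : cpp_cost (a *: x) (a *: X) = a * cpp_cost x X.
Proof. by rewrite /cpp_cost frobeniusZr dotvZr; ring. Qed.

Lemma cpp_cost0 : cpp_cost 0 0 = 0.
Proof. by rewrite /cpp_cost dotv0r /frobenius mulmx0 mxtrace0 mulr0 addr0. Qed.

Lemma row_square_mapD X Y :
  row_square_map A (X + Y) = row_square_map A X + row_square_map A Y.
Proof. by apply/colP => i; rewrite !mxE frobeniusDr. Qed.

Lemma row_square_mapZ a X :
  row_square_map A (a *: X) = a *: row_square_map A X.
Proof. by apply/colP => i; rewrite !mxE frobeniusZr. Qed.

Lemma row_square_map0 : row_square_map A 0 = 0.
Proof. by rewrite -[0 in LHS](scale0r 0) row_square_mapZ scale0r. Qed.

Lemma frobenius_row_square_adj v X :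
  frobenius (row_square_adj A v) X = dotv v (row_square_map A X).
Proof.
rewrite /row_square_adj frobenius_suml dotvE; apply: eq_bigr => i _.
by rewrite frobeniusZl mxE.
Qed.

Lemma row_square_adj_sym v : symmetric_mx (row_square_adj A v).
Proof.
rewrite /symmetric_mx /= /row_square_adj raddf_sum; apply: eq_bigr => i _.
by rewrite /= linearZ /= /row_square trmx_mul trmxK.
Qed.

(** The equality constraints of the copositive program express that the pairing
    of its matrix with a primal matrix is, up to the contribution of alpha, the
    Lagrangian of the completely positive program. *)
Lemma cop_lagrangian (u v : 'cV[R]_m) (w y x : 'cV[R]_n) (Y X : 'M[R]_n) :
    2 *: y = 2 *: c + A^T *m u - \sum_(j in B) w j 0 *: unitv j ->
    Y = Q + row_square_adj A v + \sum_(j in B) w j 0 *: delta_mx j j ->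
  2 * dotv y x + frobenius Y X =
  cpp_cost x X + dotv u (A *m x) + dotv v (row_square_map A X)
    + \sum_(j in B) w j 0 * (X j j - x j 0).
Proof.
move=> yE ->; rewrite -dotvZl yE.
rewrite !frobeniusDl frobenius_row_square_adj frobenius_suml.
rewrite !dotvDl dotvNl dotvZl dotv_mulmx dotv_suml.
under eq_bigr do rewrite dotvZl dotv_unit.
under [X in _ + (_ + X)]eq_bigr do rewrite frobeniusZl frobenius_delta.
under [X in _ = _ + X]eq_bigr do rewrite mulrBr.
by rewrite sumrB /cpp_cost; ring.
Qed.

Lemma cop_cpp_weak_duality d p :
    cop_feasible Q c A B d -> cpp_feasible A B beta p ->
  cop_objective beta d <= cpp_cost p.1 p.2.
Proof.
move=> [yE YE Mc u0 v0] [Ax AX Xj Pc].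
have := copositive_cp_ge0 Mc Pc.
rewrite frobenius_bordered mulr1 -addrA (cop_lagrangian _ _ yE YE).
rewrite big1 => [|j jB]; last by rewrite Xj // subrr mulr0.
have := ler_dotvr u0 Ax; have := ler_dotvr v0 AX; rewrite /cop_objective; lra.
Qed.

(** The homogenised primal program: the corner entry 1 of the bordered matrix
    becomes t, and the right-hand sides are multiplied by t. The feasible points
    of the completely positive program are the points with t = 1, and its
    recession directions have t = 0. *)
Definition cpp_cone (t : R) (x : 'cV[R]_n) (X : 'M[R]_n) : Prop :=
  [/\ lev (A *m x) (t *: beta),
      lev (row_square_map A X) (t *: hadamard beta beta),
      forall j, j \in B -> X j j = x j 0 &
      completely_positive (bordered t x X)].

Lemma cpp_coneD t x X t' x' X' :
  cpp_cone t x X -> cpp_cone t' x' X' -> cpp_cone (t + t') (x + x') (X + X').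
Proof.
move=> [h1 h2 h3 h4] [k1 k2 k3 k4]; split.
- move=> i; rewrite mulmxDr scalerDl [leLHS]mxE [leRHS]mxE.
  exact: lerD (h1 i) (k1 i).
- move=> i; rewrite row_square_mapD scalerDl [leLHS]mxE [leRHS]mxE.
  exact: lerD (h2 i) (k2 i).
- by move=> j jB; rewrite !mxE h3 // k3.
- by rewrite -borderedD; apply: cpD.
Qed.

Lemma cpp_coneZ a t x X : 0 <= a ->
  cpp_cone t x X -> cpp_cone (a * t) (a *: x) (a *: X).
Proof.
move=> a0 [h1 h2 h3 h4]; split.
- move=> i; rewrite -scalemxAr -scalerA [leLHS]mxE [leRHS]mxE.
  exact: ler_wpM2l (h1 i).
- move=> i; rewrite row_square_mapZ -scalerA [leLHS]mxE [leRHS]mxE.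
  exact: ler_wpM2l (h2 i).
- by move=> j jB; rewrite !mxE h3.
- by rewrite -borderedZ; apply: cpZ.
Qed.

Lemma cpp_cone1 p : cpp_feasible A B beta p <-> cpp_cone 1 p.1 p.2.
Proof. by rewrite /cpp_cone !scale1r. Qed.

(** By homogeneity, a lower bound of the optimal value scales with t. *)
Lemma cpp_cone_lower mu t x X :
    (forall p, cpp_feasible A B beta p -> mu <= cpp_cost p.1 p.2) ->
    cpp_feasible A B beta !=set0 ->
  cpp_cone t x X -> t * mu <= cpp_cost x X.
Proof.
move=> mu_le [p0 /cpp_cone1 p0F] hC.
have t0 : 0 <= t by case: hC => _ _ _; exact: cp_bordered_ge0.
(* Perturbing by the feasible point makes t positive, which covers the
   recession directions t = 0. *)
have step e : 0 < e -> (t + e) * mu <= cpp_cost x X + e * cpp_cost p0.1 p0.2.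
  move=> e0; have te : 0 < t + e by rewrite ltr_wpDl.
  have := cpp_coneD hC (cpp_coneZ (ltW e0) p0F); rewrite mulr1.
  have ti : 0 <= (t + e)^-1 by rewrite invr_ge0 ltW.
  move=> /(cpp_coneZ ti); rewrite mulVf ?gt_eqF // => hF.
  have := mu_le (_, _) ((cpp_cone1 (_, _)).2 hF).
  by rewrite /= cpp_costZ cpp_costD cpp_costZ mulrC ler_pdivlMr // mulrC.
apply/ler_addgt0Pr => e e0.
pose K := `|cpp_cost p0.1 p0.2 - mu|.
have K0 : 0 < 1 + K by rewrite ltr_pwDl // normr_ge0.
have := step (e / (1 + K)) (divr_gt0 e0 K0).
have : e / (1 + K) * (cpp_cost p0.1 p0.2 - mu) <= e.
  rewrite mulrAC ler_pdivrMr // ler_pM2l // (le_trans (ler_norm _)) //.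
  by rewrite -/K; lra.
lra.
Qed.

(** Slater's condition makes every constraint value reachable by the
    homogenised program: up to scaling, the value is small, and a small symmetric
    perturbation of the strictly feasible point reaches it, since such a
    perturbation stays completely positive and keeps the inequalities strict. *)
Lemma cpp_strong_duality mu :
    symmetric_mx Q -> cpp_slater A B beta ->
    (forall p, cpp_feasible A B beta p -> mu <= cpp_cost p.1 p.2) ->
  exists2 d, cop_feasible Q c A B d & cop_objective beta d = mu.
Proof.
move=> sQ [p0 [p0F p0u p0v p0int]] mu_le.
pose G1 t x := A *m x - t *: beta.
pose G2 t X := row_square_map A X - t *: hadamard beta beta.
(* C g r: the homogenised program is feasible, at cost at most r, after its
   right-hand sides are perturbed by the three blocks of g. The coordinates
   outside B of the third block are unconstrained. *)
pose C (g : 'cV[R]_(m + (m + n))) (r : R) := exists t x X,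
  [/\ lev (G1 t x) (usubmx g), lev (G2 t X) (usubmx (dsubmx g)),
     forall j, j \in B -> X j j - x j 0 = dsubmx (dsubmx g) j 0,
     completely_positive (bordered t x X) & cpp_cost x X - t * mu <= r].
have G1D t x t' x' : G1 (t + t') (x + x') = G1 t x + G1 t' x'.
  by rewrite /G1 mulmxDr scalerDl opprD addrACA.
have G2D t X t' X' : G2 (t + t') (X + X') = G2 t X + G2 t' X'.
  by rewrite /G2 row_square_mapD scalerDl opprD addrACA.
have G1Z a t x : G1 (a * t) (a *: x) = a *: G1 t x.
  by rewrite /G1 -scalemxAr -scalerA scalerBr.
have G2Z a t X : G2 (a * t) (a *: X) = a *: G2 t X.
  by rewrite /G2 row_square_mapZ -scalerA scalerBr.
have CD g r h s : C g r -> C h s -> C (g + h) (r + s).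
  move=> [t [x [X [h1 h2 h3 h4 h5]]]] [t' [x' [X' [k1 k2 k3 k4 k5]]]].
  exists (t + t'), (x + x'), (X + X'); split.
  - by move=> i; rewrite G1D raddfD [leLHS]mxE [leRHS]mxE lerD.
  - by move=> i; rewrite G2D !raddfD [leLHS]mxE [leRHS]mxE lerD.
  - by move=> j jB; rewrite !raddfD /= [RHS]mxE -h3 // -k3 // !mxE; ring.
  - by rewrite -borderedD; apply: cpD.
  - by rewrite cpp_costD; lra.
have CZ (a : R) g r : 0 < a -> C g r -> C (a *: g) (a * r).
  move=> a0 [t [x [X [h1 h2 h3 h4 h5]]]].
  exists (a * t), (a *: x), (a *: X); split.
  - by move=> i; rewrite G1Z linearZ [leLHS]mxE [leRHS]mxE ler_pM2l.
  - by move=> i; rewrite G2Z !linearZ [leLHS]mxE [leRHS]mxE ler_pM2l.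
  - by move=> j jB; rewrite !linearZ /= [RHS]mxE -h3 // !mxE; ring.
  - by rewrite -borderedZ; apply: cpZ => //; exact: ltW.
  - by rewrite cpp_costZ -mulrA -mulrBr ler_pM2l.
have C0 r : C 0 r -> 0 <= r.
  move=> [t [x [X [h1 h2 h3 h4 h5]]]].
  suff : t * mu <= cpp_cost x X by lra.
  apply: cpp_cone_lower mu_le _ _; first by exists p0.
  split=> //.
  - move=> i; have := h1 i; rewrite /G1 raddf0 mxE [X in _ + X]mxE [leRHS]mxE.
    by rewrite subr_le0.
  - move=> i; have := h2 i; rewrite /G2 !raddf0 mxE [X in _ + X]mxE [leRHS]mxE.
    by rewrite subr_le0.
  - by move=> j jB; have := h3 j jB; rewrite !raddf0 mxE => /subr0_eq.
have CT g : exists r, C g r.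
  pose h := dsubmx (dsubmx g).
  (* D moves X_jj - x_j by the prescribed amounts, for j in B. *)
  pose D : 'M[R]_n := \sum_(j in B) h j 0 *: delta_mx j j.
  have sD : symmetric_mx (bordered 0 (0 : 'cV[R]_n) D).
    apply: bordered_sym; rewrite /symmetric_mx /= raddf_sum.
    by apply: eq_bigr => j _; rewrite /= linearZ /= trmx_delta.
  have DE j : j \in B -> D j j = h j 0.
    move=> jB; rewrite summxE (bigD1 j) //= big1 => [|i /andP[_ ij]].
      by rewrite !mxE !eqxx mulr1 addr0.
    by rewrite !mxE eq_sym (negbTE ij) mulr0.
  pose gu := usubmx g.
  pose gv := usubmx (dsubmx g) - row_square_map A D.
  have near_cp := symmetric_interior_near p0int sD.
  have near_u : \forall e \near (0 : R)^'+,
      forall i, G1 1 p0.1 i 0 <= e * gu i 0.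
    apply: filter_forall => i; apply: neg_near_le_scale.
    by rewrite /G1 mxE [X in _ + X]mxE scale1r subr_lt0.
  have near_v : \forall e \near (0 : R)^'+,
      forall i, G2 1 p0.2 i 0 <= e * gv i 0.
    apply: filter_forall => i; apply: neg_near_le_scale.
    by rewrite /G2 mxE [X in _ + X]mxE scale1r subr_lt0.
  near (0 : R)^'+ => e.
  have e0 : 0 < e by near: e; exact: nbhs_right_gt.
  (* C is a cone, so it is enough to reach a small multiple of g. *)
  suff [r Cr] : exists r, C (e *: g) r.
    have ei : 0 < e^-1 by rewrite invr_gt0.
    exists (e^-1 * r); have := CZ _ _ _ ei Cr.
    by rewrite scalerA mulVf ?gt_eqF // scale1r.
  exists (cpp_cost p0.1 (p0.2 + e *: D) - 1 * mu), 1, p0.1, (p0.2 + e *: D).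
  split.
  - move=> i; rewrite linearZ [leRHS]mxE; move: i; near: e; exact: near_u.
  - have hv : forall i, G2 1 p0.2 i 0 <= e * gv i 0 by near: e; exact: near_v.
    move=> i; have := hv i.
    rewrite /gv /G2 row_square_mapD row_square_mapZ !linearZ /=.
    move: (row_square_map A p0.2) (row_square_map A D) (hadamard _ _).
    by move=> a b1 b2; rewrite !mxE; lra.
  - move=> j jB; rewrite !linearZ /= [RHS]mxE -/h [X in X - _]mxE.
    rewrite [X in _ + X - _]mxE DE //.
    by case: p0F => _ _ -> // _; ring.
  - have : completely_positive (bordered 1 p0.1 p0.2 + e *: bordered 0 0 D).
      by near: e; exact: near_cp.
    by rewrite borderedZ borderedD mulr0 addr0 scaler0 addr0.
  - by [].
(* The prices are the opposites of the blocks of the multiplier. *)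
have [l lC] := multiplier_exists CD CZ C0 CT.
pose u := - usubmx l.
pose v := - usubmx (dsubmx l).
pose w := - dsubmx (dsubmx l).
have lE : l = - col_mx u (col_mx v w).
  by rewrite !opp_col_mx !opprK !vsubmxK.
have lP g1 g2 g3 r : C (col_mx g1 (col_mx g2 g3)) r ->
    0 <= r + dotv u g1 + dotv v g2 + dotv w g3.
  by move=> /lC; rewrite lE dotvNl !dotv_col; lra.
(* C is upward closed in the first two blocks: slack has cost 0. *)
have u0 : nonnegv u.
  move=> i; rewrite mxE -dotv_unit dotvC.
  suff /lP : C (col_mx (unitv i) (col_mx 0 0)) 0.
    by rewrite !dotv0r; lra.
  exists 0, 0, 0; rewrite !col_mxKd !col_mxKu; split.
  - by move=> j; rewrite /G1 mulmx0 scale0r subr0 !mxE ler0n.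
  - by move=> j; rewrite /G2 row_square_map0 scale0r subr0.
  - by move=> j _; rewrite !mxE subrr.
  - by rewrite bordered0; exact: cp0.
  - by rewrite cpp_cost0 mul0r subr0.
have v0 : nonnegv v.
  move=> i; rewrite mxE -dotv_unit dotvC.
  suff /lP : C (col_mx 0 (col_mx (unitv i) 0)) 0.
    by rewrite !dotv0r; lra.
  exists 0, 0, 0; rewrite !col_mxKd !col_mxKu; split.
  - by move=> j; rewrite /G1 mulmx0 scale0r subr0.
  - by move=> j; rewrite /G2 row_square_map0 scale0r subr0 !mxE ler0n.
  - by move=> j _; rewrite !mxE subrr.
  - by rewrite bordered0; exact: cp0.
  - by rewrite cpp_cost0 mul0r subr0.
pose y := 2^-1 *: (2 *: c + A^T *m u - \sum_(j in B) w j 0 *: unitv j).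
pose Y := Q + row_square_adj A v + \sum_(j in B) w j 0 *: delta_mx j j.
pose a := - mu - dotv u beta - dotv v (hadamard beta beta).
have yE : 2 *: y = 2 *: c + A^T *m u - \sum_(j in B) w j 0 *: unitv j.
  by rewrite scalerA mulfV ?scale1r // pnatr_eq0.
exists (CopPoint a u v w y Y); last by rewrite /cop_objective /= /a; ring.
split=> //=; apply/copositive_bordered; split.
  have sw : symmetric_mx (\sum_(j in B) w j 0 *: (delta_mx j j : 'M[R]_n)).
    rewrite /symmetric_mx /= raddf_sum.
    by apply: eq_bigr => j _; rewrite /= linearZ /= trmx_delta.
  have sv := row_square_adj_sym v.
  by move: sQ sv sw; rewrite /symmetric_mx /Y /= !raddfD /= => -> -> ->.
move=> t x t0 x0.
pose tx := t *: x; pose X := x *m x^T.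
pose h : 'cV[R]_n := \col_j (if j \in B then X j j - tx j 0 else 0).
have : C (col_mx (G1 (t ^+ 2) tx) (col_mx (G2 (t ^+ 2) X) h))
    (cpp_cost tx X - t ^+ 2 * mu).
  exists (t ^+ 2), tx, X; rewrite !col_mxKd !col_mxKu; split=> //.
  - by move=> j jB; rewrite !mxE jB.
  - rewrite -bordered_outer; apply/cp_outer/nonnegv_col; split=> // i.
    by rewrite ord1 !mxE mulr1n.
move=> /lP.
have -> : dotv w h = \sum_(j in B) w j 0 * (X j j - tx j 0).
  rewrite dotvE [RHS]big_mkcond; apply: eq_bigr => j _.
  by rewrite [h j 0]mxE; case: ifP => _; rewrite ?mulr0.
rewrite /G1 /G2 !dotvDr !dotvNr !dotvZr.
have := cop_lagrangian tx X yE (erefl Y).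
rewrite {1}/tx dotvZr frobenius_outer /a; lra.
Unshelve. all: by end_near. Qed.

End Duality.

(** * The price allocation *)

Section Allocation.
Context {R : realType} {N : finType} {n m : nat}.
Variables (Q : 'M[R]_n) (c : 'cV[R]_n) (A : 'M[R]_(m, n)) (B : {set 'I_n}).
Variables (b : N -> 'cV[R]_m) (nu : {set N} -> R).

Hypothesis b_ge0 : forall i : N, nonnegv (b i).
Hypothesis nu_cpp : forall S : {set N}, S != finset.set0 ->
  (nu S)%:E = cpp_value Q c A B (pooled b S).

Lemma nu_le_cpp S p : S != finset.set0 ->
  cpp_feasible A B (pooled b S) p -> nu S <= cpp_cost Q c p.1 p.2.
Proof.
move=> /nu_cpp nuE pF; rewrite -lee_fin nuE.
by apply: ereal_inf_lbound; exists p.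
Qed.

Lemma nu_ge S z : S != finset.set0 ->
    (forall p, cpp_feasible A B (pooled b S) p ->
      z <= cpp_cost Q c p.1 p.2) ->
  z <= nu S.
Proof.
move=> /nu_cpp nuE zle; rewrite -lee_fin nuE.
by apply: le_ereal_inf_tmp => _ [p pF <-]; rewrite lee_fin; exact: zle.
Qed.

Lemma pooled_ge0 S : nonnegv (pooled b S).
Proof.
move=> i; rewrite /pooled summxE mxE sumr_ge0 // => j _.
by have := b_ge0 j i; rewrite mxE.
Qed.

Lemma pooled_le_setT S : lev (pooled b S) (pooled b (finset.setTfor N)).
Proof.
move=> i; rewrite /pooled !summxE [leRHS](big_setID S) /= finset.setTI.
rewrite lerDl sumr_ge0 // => j _.
by have := b_ge0 j i; rewrite mxE.
Qed.

Lemma hadamard_pooled (S : {set N}) (y : 'cV[R]_m) :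
  hadamard (pooled b S) y = \sum_(i in S) hadamard (b i) y.
Proof.
apply/colP => k; rewrite mxE /pooled !summxE mulr_suml.
by apply: eq_bigr => i _; rewrite mxE.
Qed.

(** The share of player i: an equal part of the constant - alpha, minus the
    value of the resources b(i) at the prices u and v. The quadratic resource
    b o b is not additive over players; its value b(N) o b(N) is split linearly,
    as the products b(i) o b(N). *)
Definition price_allocation (d : cop_point R n m) (i : N) : R :=
  - (cop_alpha d / #|N|%:R) - dotv (cop_u d) (b i)
  - dotv (cop_v d) (hadamard (b i) (pooled b (finset.setTfor N))).

Lemma price_allocation_sum d (S : {set N}) :
  \sum_(i in S) price_allocation d i =
  - (cop_alpha d / #|N|%:R * #|S|%:R) - dotv (cop_u d) (pooled b S)
  - dotv (cop_v d) (hadamard (pooled b S) (pooled b (finset.setTfor N))).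
Proof.
rewrite hadamard_pooled /pooled !dotv_sumr /price_allocation !sumrB.
by rewrite sumr_const mulNrn mulr_natr.
Qed.

Lemma price_allocation_le d (S : {set N}) :
    S != finset.set0 -> cop_feasible Q c A B d ->
    copositive (bordered (cop_alpha d / #|N|%:R) (cop_y d) (cop_Y d)) ->
  \sum_(i in S) price_allocation d i <= nu S.
Proof.
move=> S0 [yE YE Mc u0 v0] Mc'; apply: nu_ge => // p pF.
pose d' := CopPoint (cop_alpha d / #|N|%:R * #|S|%:R) (cop_u d) (cop_v d)
  (cop_w d) (cop_y d) (cop_Y d).
have d'F : cop_feasible Q c A B d'.
  split=> //=; apply: (copositive_bordered_le _ Mc').
  apply: ler_peMr; first exact: copositive_bordered_ge0 Mc'.
  by rewrite ler1n card_gt0.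
apply: le_trans (cop_cpp_weak_duality d'F pF).
rewrite price_allocation_sum /cop_objective /= lerB //.
apply: ler_dotvr v0 _ => i; rewrite !mxE ler_wpM2l ?pooled_le_setT //.
by have := pooled_ge0 S i; rewrite mxE.
Qed.

(** The Slater condition and the optimality of d enter only in the budget
    balance. *)
Lemma core_of_copositive d :
    (0 < #|N|)%N -> symmetric_mx Q ->
    cpp_slater A B (pooled b (finset.setTfor N)) ->
    cop_optimal Q c A B (pooled b (finset.setTfor N)) d ->
    copositive (bordered (cop_alpha d / #|N|%:R) (cop_y d) (cop_Y d)) ->
  core nu (price_allocation d).
Proof.
move=> N0 sQ sl [dF dmax] Mc.
have T0 : finset.setTfor N != finset.set0.
  by rewrite -card_gt0 cardsT.
split=> [|S S0]; last exact: price_allocation_le.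
have sumT : \sum_i price_allocation d i =
    \sum_(i in finset.setTfor N) price_allocation d i.
  by apply: eq_bigl => i; rewrite inE.
apply: le_anti; apply/andP; split; first by rewrite sumT price_allocation_le.
have [d' d'F <-] := cpp_strong_duality sQ sl (fun p => @nu_le_cpp _ p T0).
rewrite sumT price_allocation_sum cardsT -mulrA mulVf ?mulr1; last first.
  by rewrite pnatr_eq0 -lt0n.
exact: dmax.
Qed.

End Allocation.

Theorem theorem18 (R : realType) (N : finType) (n m : nat)
  (Q : 'M[R]_n) (c : 'cV[R]_n) (A : 'M[R]_(m, n)) (B : {set 'I_n})
  (b : N -> 'cV[R]_m) (nu : {set N} -> R) (d : cop_point R n m)
  (N_gt0 : (0 < #|N|)%N)
  (Q_sym : symmetric_mx Q)
  (b_ge0 : forall i : N, nonnegv (b i))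
  (nu_mbqp : forall S : {set N}, S != finset.set0 ->
     (nu S)%:E = mbqp_value Q c A B (pooled b S))
  (binary_bounds : forall S : {set N}, S != finset.set0 ->
     forall x : 'cV[R]_n, nonnegv x -> A *m x = pooled b S ->
     forall j : 'I_n, j \in B -> 0 <= x j 0 <= 1)
  (nu_cpp : forall S : {set N}, S != finset.set0 ->
     (nu S)%:E = cpp_value Q c A B (pooled b S))
  (slater : cpp_slater A B (pooled b (finset.setTfor N)))
  (d_opt : cop_optimal Q c A B (pooled b (finset.setTfor N)) d) :
  (nonnegv (cop_y d) -> core nu !=set0) /\
  ((cop_ratio_sup d <= (1 / #|N|%:R)%:E)%E -> core nu !=set0).
Proof.
have [[_ _ Mc _ _] _] := d_opt.
have Nr0 : (0 : R) < #|N|%:R by rewrite ltr0n.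
split=> [y0|sup_le]; exists (price_allocation b d);
  apply: (core_of_copositive b_ge0 nu_cpp N_gt0 Q_sym slater d_opt).
- apply: (copositive_bordered_nonneg y0 _ Mc).
  by rewrite divr_ge0 ?(copositive_bordered_ge0 Mc) // ltW.
- rewrite mulrC -div1r; apply: copositive_bordered_ratio sup_le Mc.
  by rewrite divr_gt0.
Qed.
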